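(* Let $B$ be a Banach space and let $0\le\alpha<\frac12$. Then the multivalued mapping $P\mapsto URetr(P)$, from $bexp_\alpha(B)$ to $C_b(B,B)$, admits a singlevalued continuous selection; that is, there is a continuous mapping $\mathfrak{R}:bexp_\alpha(B)\to C_b(B,B)$, $P\mapsto\mathfrak{R}_P$, such that $\mathfrak{R}_P\in URetr(P)$ for every $P\in bexp_\alpha(B)$.
   Context: For a number $\alpha\ge 0$, a nonempty closed subset $P$ of a normed space $Y$ is called $\alpha$-paraconvex if for every $r>0$, every open ball $D_r\subset Y$ of radius $r$ and every $q\in \mathrm{conv}(P\cap D_r)$ one has $\mathrm{dist}(q,P)\le \alpha\cdot r$. For $0\le\alpha<1$ and a Banach space $B$, $bexp_\alpha(B)$ is the family of all $\alpha$-paraconvex bounded subsets of $B$ endowed with the Hausdorff metric; the Hausdorff distance between two bounded sets is the infimum of all $\varepsilon>0$ such that each of the sets is contained in the open $\varepsilon$-neighborhood of the other. $C_b(B,B)$ is the Banach space of all continuous bounded mappings of $B$ into itself, with the sup norm. A continuous retraction of $B$ onto $A\subset B$ is a continuous map $R:B\to B$ with $R(B)\subset A$ and $R(a)=a$ for all $a\in A$. It is called uniform (with respect to $A$) if for every $\varepsilon>0$ there exists $\delta>0$ such that for all $x\in B$: $\mathrm{dist}(x,A)<\delta$ implies $\mathrm{dist}(x,R(x))<\varepsilon$. (This is not uniform continuity of $R$.) $URetr(A)$ denotes the set of all continuous retractions of $B$ onto $A$ which are uniform with respect to $A$. *)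

(* Defs.v *)
From HB Require Import structures.
From mathcomp Require Import all_boot all_order all_algebra.
From mathcomp Require Import all_classical all_reals all_analysis.

Set Implicit Arguments.
Unset Strict Implicit.
Unset Printing Implicit Defensive.

Import Order.TTheory GRing.Theory Num.Theory.
Import numFieldNormedType.Exports.

Local Open Scope classical_set_scope.
Local Open Scope ring_scope.

Section Paraconvexity.
Context {R : realType} {B : normedModType R}.
Implicit Types (P Q : set B) (alpha : R).

(* The infimum is taken in [R], so the value is only meaningful for [P]
   nonempty, which every paraconvex set is. *)
Definition set_dist (x : B) P : R := inf [set `|x - p| | p in P].

Definition conv_hull P : set B := smallest (@convex_set R B) P.

Definition paraconvex alpha P : Prop :=
  [/\ P !=set0, closed P &
      forall (r : R) (c q : B), 0 < r ->
        conv_hull (P `&` ball c r) q -> set_dist q P <= alpha * r].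

Definition open_nbhd P (e : R) : set B := \bigcup_(p in P) ball p e.

Definition hausdorff_radii P Q : set R :=
  [set e | [/\ 0 < e, P `<=` open_nbhd Q e & Q `<=` open_nbhd P e]].

Definition hausdorff_dist P Q : R := inf (hausdorff_radii P Q).

Lemma hausdorff_radii_sym P Q : hausdorff_radii P Q = hausdorff_radii Q P.
Proof. by apply/seteqP; split => e [? ? ?]; split. Qed.

Lemma hausdorff_radii_lbound P Q : lbound (hausdorff_radii P Q) 0.
Proof. by move=> e [/ltW]. Qed.

Lemma hausdorff_radii_le P Q (d e : R) :
  d <= e -> hausdorff_radii P Q d -> hausdorff_radii P Q e.
Proof.
move=> de [d0 PQ QP]; split; first exact: lt_le_trans de.
- by move=> x /PQ[q Qq xq]; exists q => //; exact: le_ball xq.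
- by move=> x /QP[q Qq xq]; exists q => //; exact: le_ball xq.
Qed.

Lemma hausdorff_radii_refl P (e : R) : 0 < e -> hausdorff_radii P P e.
Proof. by move=> e0; split => // x Px; exists x => //; exact: ballxx. Qed.

Lemma hausdorff_radii_triangle Q P S (d e : R) :
  hausdorff_radii P Q d -> hausdorff_radii Q S e ->
  hausdorff_radii P S (d + e).
Proof.
move=> [d0 PQ QP] [e0 QS SQ]; split; first exact: addr_gt0.
- move=> x /PQ[q /QS[s Ss sq] qx]; exists s => //.
  by rewrite addrC; exact: ball_triangle sq qx.
- move=> x /SQ[q /QP[s Ss sq] qx]; exists s => //.
  exact: ball_triangle sq qx.
Qed.

Lemma hausdorff_radii_neq0 P Q :
  P !=set0 -> Q !=set0 -> bounded_set P -> bounded_set Q ->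
  hausdorff_radii P Q !=set0.
Proof.
move=> [p Pp] [q Qq] /ex_strict_bound_gt0[M M0 PM] /ex_strict_bound_gt0[N N0 QN].
have le0 x y : P x -> Q y -> `|x - y| < M + N.
  move=> /PM xM /QN yN; apply: le_lt_trans (ler_normB _ _) _.
  by rewrite ltrD.
exists (M + N); split; first exact: addr_gt0.
- by move=> x Px; exists q => //; rewrite -ball_normE/= distrC; exact: le0.
- by move=> x Qx; exists p => //; rewrite -ball_normE/=; exact: le0.
Qed.

Lemma hausdorff_radii_closed P Q :
  closed Q -> (forall e, 0 < e -> hausdorff_radii P Q e) -> P `<=` Q.
Proof.
move=> cQ PQ x Px; apply: cQ => A /nbhs_ballP[e /= e0 eA].
have [_ /(_ _ Px)[q Qq qx] _] := PQ _ e0.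
by exists q; split => //; apply: eA; exact: ball_sym.
Qed.

End Paraconvexity.

Record bexp (R : realType) (B : normedModType R) (alpha : R) := Bexp {
  bexp_set :> set B;
  bexp_paraconvex : paraconvex alpha bexp_set;
  bexp_bounded : bounded_set bexp_set }.

Section BexpMetric.
Context {R : realType} {B : normedModType R} {alpha : R}.
Implicit Types P Q S : bexp B alpha.

HB.instance Definition _ := gen_eqMixin (bexp B alpha).
HB.instance Definition _ := gen_choiceMixin (bexp B alpha).

Definition bexp_dist P Q : R := hausdorff_dist P Q.

Lemma bexp_inj P Q : bexp_set P = bexp_set Q -> P = Q.
Proof.
case: P Q => [P p1 p2] [Q q1 q2] /= PQ; rewrite PQ in p1 p2 *.
by rewrite (Prop_irrelevance p1 q1) (Prop_irrelevance p2 q2).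
Qed.

Lemma bexp_has_inf P Q : has_inf (hausdorff_radii P Q).
Proof.
split; last by exists 0; exact: hausdorff_radii_lbound.
have [P0 _ _] := bexp_paraconvex P; have [Q0 _ _] := bexp_paraconvex Q.
by apply: hausdorff_radii_neq0 => //; exact: bexp_bounded.
Qed.

Lemma bexp_dist_ltP P Q (e : R) :
  bexp_dist P Q < e -> hausdorff_radii P Q e.
Proof.
move=> /(inf_lt (bexp_has_inf P Q).1)[d Pd /ltW de].
exact: hausdorff_radii_le de Pd.
Qed.

Lemma bexp_dist_le P Q (e : R) :
  hausdorff_radii P Q e -> bexp_dist P Q <= e.
Proof. by apply: ge_inf; exact: (bexp_has_inf P Q).2. Qed.

Lemma bexp_dist_ge0 P Q : 0 <= bexp_dist P Q.
Proof. exact: lb_le_inf (bexp_has_inf P Q).1 (@hausdorff_radii_lbound _ _ P Q). Qed.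

Lemma bexp_distxx P : bexp_dist P P = 0.
Proof.
apply/eqP; rewrite eq_le bexp_dist_ge0 andbT; apply/ler_addgt0Pr => e e0.
by rewrite add0r; apply: bexp_dist_le; exact: hausdorff_radii_refl.
Qed.

Lemma bexp_dist_sym P Q : bexp_dist P Q = bexp_dist Q P.
Proof. by rewrite /bexp_dist /hausdorff_dist hausdorff_radii_sym. Qed.

Lemma bexp_dist_positivity P Q : bexp_dist P Q = 0 -> P = Q.
Proof.
move=> PQ0; apply: bexp_inj.
have PQ e : 0 < e -> hausdorff_radii P Q e.
  by move=> e0; apply: bexp_dist_ltP; rewrite PQ0.
have [_ cP _] := bexp_paraconvex P; have [_ cQ _] := bexp_paraconvex Q.
apply/seteqP; split; apply: hausdorff_radii_closed => // e /PQ.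
by rewrite hausdorff_radii_sym.
Qed.

Lemma bexp_dist_triangle Q P S :
  bexp_dist P S <= bexp_dist P Q + bexp_dist Q S.
Proof.
apply/ler_addgt0Pr => e e0; rewrite (splitr e) addrACA.
apply: bexp_dist_le; apply: (@hausdorff_radii_triangle _ _ Q);
  by apply: bexp_dist_ltP; rewrite ltrDl divr_gt0.
Qed.

HB.instance Definition _ := isMetric.Build R (bexp B alpha)
  bexp_distxx bexp_dist_positivity bexp_dist_sym bexp_dist_triangle.

End BexpMetric.

Record Cb (R : realType) (B : normedModType R) := MkCb {
  Cb_fun :> B -> B;
  Cb_continuous : continuous Cb_fun;
  Cb_bounded : bounded_fun Cb_fun }.

Section CbMetric.
Context {R : realType} {B : normedModType R}.
Implicit Types f g h : Cb B.

HB.instance Definition _ := gen_eqMixin (Cb B).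
HB.instance Definition _ := gen_choiceMixin (Cb B).

(* A supremum in [R]; meaningful for bounded [f]. *)
Definition sup_norm (f : B -> B) : R := sup [set `|f x| | x in [set: B]].

Definition Cb_dist f g : R := sup_norm (fun x => f x - g x).

Lemma Cb_inj f g : f =1 g -> f = g.
Proof.
case: f g => [f f1 f2] [g g1 g2] /= /funext fg; rewrite fg in f1 f2 *.
by rewrite (Prop_irrelevance f1 g1) (Prop_irrelevance f2 g2).
Qed.

Lemma Cb_has_sup f g : has_sup [set `|f x - g x| | x in [set: B]].
Proof.
split; first by exists `|f 0 - g 0|, 0.
have [M _ fM] := pinfty_ex_gt0 (Cb_bounded f).
have [N _ gN] := pinfty_ex_gt0 (Cb_bounded g).
exists (M + N) => _ [x _ <-]; apply: le_trans (ler_normB _ _) _.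
by rewrite lerD//; [exact: fM | exact: gN].
Qed.

Lemma Cb_dist_ub f g x : `|f x - g x| <= Cb_dist f g.
Proof. by apply: sup_upper_bound; [exact: Cb_has_sup | exists x]. Qed.

Lemma Cb_dist_le f g (e : R) :
  (forall x, `|f x - g x| <= e) -> Cb_dist f g <= e.
Proof.
by move=> fge; apply: ge_sup => [|_ [x _ <-] //]; exact: (Cb_has_sup f g).1.
Qed.

Lemma Cb_distxx f : Cb_dist f f = 0.
Proof.
apply/eqP; rewrite eq_le Cb_dist_le => [|x]; last by rewrite subrr normr0.
by rewrite (le_trans (normr_ge0 _) (Cb_dist_ub f f 0)).
Qed.

Lemma Cb_dist_positivity f g : Cb_dist f g = 0 -> f = g.
Proof.
move=> fg0; apply: Cb_inj => x; apply/eqP.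
by rewrite -subr_eq0 -normr_le0 -fg0 Cb_dist_ub.
Qed.

Lemma Cb_dist_sym f g : Cb_dist f g = Cb_dist g f.
Proof.
by apply/eqP; rewrite eq_le !Cb_dist_le// => x; rewrite distrC Cb_dist_ub.
Qed.

Lemma Cb_dist_triangle g f h : Cb_dist f h <= Cb_dist f g + Cb_dist g h.
Proof.
apply: Cb_dist_le => x; apply: le_trans (ler_distD (g x) _ _) _.
by rewrite lerD// Cb_dist_ub.
Qed.

HB.instance Definition _ := isMetric.Build R (Cb B)
  Cb_distxx Cb_dist_positivity Cb_dist_sym Cb_dist_triangle.

End CbMetric.

Section Retractions.
Context {R : realType} {B : normedModType R}.
Implicit Type A : set B.

Definition continuous_retraction A (r : B -> B) : Prop :=
  [/\ continuous r, range r `<=` A & forall a, A a -> r a = a].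

Definition uniform_wrt A (r : B -> B) : Prop :=
  forall e : R, 0 < e -> exists2 d : R, 0 < d &
    forall x, set_dist x A < d -> `|x - r x| < e.

Definition URetr A : set (Cb B) :=
  [set r | continuous_retraction A r /\ uniform_wrt A r].

End Retractions.

(* Main.v *)
(* C_b(B, B) is a Banach space and P |-> URetr(P) satisfies the hypotheses of Michael's
   selection theorem for paraconvex-valued maps on a metric (hence paracompact) space.
   Indeed Michael's theorem applied to the constant map with value P on the complement
   of P gives, as 2 (1 - alpha) > 1, a retraction rho onto P such that
   |x - rho x| <= 2 dist(x, P). If q is a convex combination of uniform retractions
   onto P lying in a ball of radius r, then dist(q(x), P) <= alpha r for all x, so that
   rho o q is a uniform retraction within 2 alpha r of q: URetr(P) is
   2 alpha-paraconvex, and 2 alpha < 1. Lower semicontinuity of P |-> URetr(P) is where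
   the uniformity of the retractions is needed. *)
Require Import Defs.
From mathcomp Require Import all_boot all_order all_algebra.
From mathcomp Require Import all_classical all_reals all_analysis.
From mathcomp Require wochoice.
From mathcomp Require Import ring lra.
Import Order.TTheory GRing.Theory Num.Theory.
Import numFieldNormedType.Exports.
Local Open Scope classical_set_scope.
Local Open Scope ring_scope.

Set Implicit Arguments.
Unset Strict Implicit.
Unset Printing Implicit Defensive.

(** * Ordering the indices of a cover, by Zermelo's theorem *)

Lemma exists_well_founded_total (I : choiceType) : exists lt : I -> I -> Prop,
  (forall i j, i <> j -> lt i j \/ lt j i) /\
  (forall A : set I, A !=set0 -> exists2 i, A i & forall j, lt j i -> ~ A j).
Proof.
have [le le_wo] := wochoice.well_ordering_principle I.
have min (A : set I) : A !=set0 -> exists2 i, A i & forall j, A j -> le i j.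
  move=> [a Aa]; have [|i [[Ai leA] _]] := le_wo [pred x | x \in A].
    by exists a; rewrite !inE.
  exists i; first by move: Ai; rewrite !inE.
  by move=> j Aj; apply: leA; rewrite !inE.
(* With [lt i j] read as the failure of [le j i], a least element of [A] is minimal at once;
   totality comes from the antisymmetry of [le]. *)
exists (fun i j => ~~ le j i); split => [i j ij|A /min[i Ai leA]]; last first.
  by exists i => // j /negP + /leA.
have [/= le_ij|] := boolP (le i j); last by right.
have [/= le_ji|] := boolP (le j i); last by left.
have le_wo2 : wochoice.wo_chain le predT by move=> A _; exact: le_wo.
case: ij; apply: (wochoice.wo_chain_antisymmetric le_wo2) => //.
by rewrite le_ij.
Qed.

(** * Lipschitz functions and their suprema *)

Section Lipschitz.
Context {R : realType} {X : pseudoMetricType R}.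
Implicit Types (f g : X -> R) (k : R).

(** Lipschitz continuity in terms of balls rather than a distance; exchanging [x] and [y] gives the
    other bound. *)
Definition lip k f := forall d x y, 0 < d -> ball x d y -> f x <= f y + k * d.

Lemma lip_continuous k f : 0 <= k -> lip k f -> continuous f.
Proof.
move=> k0 fk x; apply/cvgrPdist_le => e e0; pose d := e / (k + 1).
have k1 : 0 < k + 1 by rewrite ltr_wpDl.
have d0 : 0 < d by rewrite divr_gt0.
have kd : k * d <= e.
  by rewrite /d mulrA ler_pdivrMr// mulrC ler_pM2l// lerDl.
near=> y; have xy : ball x d y by near: y; exact: nbhsx_ballx.
have := fk _ _ _ d0 xy; have := fk _ _ _ d0 (ball_sym xy).
by rewrite ler_norml; lra.
Unshelve. all: by end_near. Qed.

Lemma lip_maxB (a b c : R) f g : 0 <= a -> 0 <= b -> 0 <= c ->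
  lip a f -> lip b g -> lip (a + c * b) (fun x => Num.max 0 (f x - c * g x)).
Proof.
move=> a0 b0 c0 fa gb d x y d0 xy; rewrite ge_max.
have cgb : c * (g y - b * d) <= c * g x.
  by rewrite ler_wpM2l// lerBlDr gb//; exact: ball_sym.
have ad0 : 0 <= a * d by rewrite mulr_ge0 // ltW.
have cbd0 : 0 <= c * b * d by rewrite !mulr_ge0 // ltW.
have := fa _ _ _ d0 xy.
have : 0 <= Num.max 0 (f y - c * g y) by rewrite le_max lexx.
have : f y - c * g y <= Num.max 0 (f y - c * g y) by rewrite le_max lexx orbT.
by move=> ? ? ?; apply/andP; split; lra.
Qed.

Context (I : Type) (phi : I -> X -> R) (k : R).
Hypothesis phi01 : forall i x, 0 <= phi i x <= 1.
Hypothesis phi_lip : forall i, lip k (phi i).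

(** Adjoining 0 makes an empty [A] yield a genuine supremum, equal to 0. *)
Definition sup_over (A : set I) (x : X) : R :=
  sup (0 |` [set phi i x | i in A]).

Lemma sup_over_ub A i x : A i -> phi i x <= sup_over A x.
Proof.
move=> Ai; apply: sup_upper_bound; last by right; exists i.
split; first by exists 0; left.
by exists 1 => _ [->|[j _ <-]]; [exact: ler01|case/andP: (phi01 j x)].
Qed.

Lemma sup_over_le A x (c : R) :
  0 <= c -> (forall i, A i -> phi i x <= c) -> sup_over A x <= c.
Proof.
move=> c0 phic; apply: ge_sup; first by exists 0; left.
by move=> _ [->|[i Ai <-]] //; exact: phic.
Qed.

Lemma sup_over_ge0 A x : 0 <= sup_over A x.
Proof.
apply: sup_upper_bound; last by left.
split; first by exists 0; left.
by exists 1 => _ [->|[j _ <-]]; [exact: ler01|case/andP: (phi01 j x)].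
Qed.

Lemma sup_over_lip A : 0 <= k -> lip k (sup_over A).
Proof.
move=> k0 d x y d0 xy; apply: sup_over_le => [|i Ai].
  by rewrite addr_ge0 ?sup_over_ge0// mulr_ge0// ltW.
by apply: le_trans (phi_lip i d0 xy) _; rewrite lerD2r sup_over_ub.
Qed.

Lemma sup_over_gt A x (c : R) :
  0 <= c -> c < sup_over A x -> exists2 i, A i & c < phi i x.
Proof.
move=> c0 cA; apply: contrapT => nA; move: cA; rewrite ltNge => /negP; apply.
apply: sup_over_le => // i Ai; rewrite leNgt; apply/negP => ci.
by apply: nA; exists i.
Qed.

End Lipschitz.

(** * Depth of a point in an open set *)

Section Depth.
Context {R : realType} {X : pseudoMetricType R}.
Implicit Type U : set X.

(** The distance to the complement of [U], cut off at 1. The guard [0 < r] puts 0 in the set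
    whatever [ball x 0] is. *)
Definition depth U (x : X) : R :=
  sup [set r | 0 <= r <= 1 /\ (0 < r -> ball x r `<=` U)].

Let depth_has_sup U x :
  has_sup [set r : R | 0 <= r <= 1 /\ (0 < r -> ball x r `<=` U)].
Proof.
by split; [exists 0; split; rewrite ?lexx ?ltxx//= ler01|exists 1 => r [/andP[]]].
Qed.

Lemma depth01 U x : 0 <= depth U x <= 1.
Proof.
apply/andP; split.
  by apply: sup_upper_bound => //; split; rewrite ?lexx ?ltxx//= ler01.
by apply: ge_sup; [exact: (depth_has_sup U x).1|move=> r [/andP[]]].
Qed.

Lemma depth_gt0 U x : open U -> U x -> 0 < depth U x.
Proof.
move=> oU Ux; have /nbhs_ballP[e /= e0 eU] := open_nbhs_nbhs (conj oU Ux).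
apply: (@lt_le_trans _ _ (Num.min e 1)); first by rewrite lt_min e0 ltr01.
apply: sup_upper_bound => //; split.
  by rewrite le_min (ltW e0) ler01/= ge_min lexx orbT.
by move=> _ y xy; apply: eU; apply: le_ball xy; rewrite ge_min lexx.
Qed.

Lemma depth_gt0_mem U x : 0 < depth U x -> U x.
Proof.
move=> /(sup_gt (depth_has_sup U x).1)[r [_ rU] r0].
by apply: (rU r0); exact: ballxx.
Qed.

(** The ball of radius [r - d] about [y] lies in the ball of radius [r] about [x]. *)
Lemma depth_lip U : lip 1 (depth U).
Proof.
move=> d x y d0 xy; rewrite mul1r; apply: ge_sup.
  exact: (depth_has_sup U x).1.
move=> r [/andP[r0 r1] rU]; have [rd|dr] := leP r d.
  by apply: le_trans rd _; rewrite lerDr; case/andP: (depth01 U y).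
rewrite -lerBlDr; apply: sup_upper_bound => //; split.
  by rewrite subr_ge0 (ltW dr)/= lerBlDr (le_trans r1)// lerDl ltW.
move=> _ z yz; apply: rU; first exact: lt_trans d0 dr.
by have := ball_triangle xy yz; rewrite addrC subrK.
Qed.

End Depth.

(** * Locally finite partitions of unity *)

Lemma separated_finite (R : realType) (I : Type) (A : set I) (v : I -> R) (c : R) :
  0 < c -> (forall i, A i -> 0 <= v i <= 1) ->
  (forall i j, A i -> A j -> i <> j -> c < `|v i - v j|) -> finite_set A.
Proof.
move=> c0 v01 sep; pose N := (Num.truncn c^-1).+1.
(* Values in one cell of length [c] differ by at most [c], so the cell number is injective on [A];
   indices outside [A] get [N], above every cell number. *)
pose f i := if `[< A i >] then Num.truncn (v i / c) else N.
have vc i : A i -> 0 <= v i / c by move=> /v01/andP[? _]; rewrite divr_ge0// ltW.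
have : finite_set (f @^-1` `I_N).
  apply: finite_preimage => // i j; rewrite !inE /= /f.
  case: asboolP => [Ai _|]; last by rewrite ltnn.
  case: asboolP => [Aj _ fij|]; last by rewrite ltnn.
  apply: contrapT => ij; have := sep _ _ Ai Aj ij; apply/negP; rewrite -leNgt.
  have /andP[i1 i2] := truncn_itv (vc _ Ai).
  have /andP[j1 j2] := truncn_itv (vc _ Aj).
  rewrite -[leRHS]mul1r -ler_pdivrMr// -[X in `|_| / X]gtr0_norm// -normf_div.
  by rewrite mulrBl; move: i1 i2 j1 j2; rewrite fij -!natr1 ler_norml; lra.
apply: sub_finite_set => i Ai; rewrite /f /= asboolT// /N ltnS.
apply: le_truncn; rewrite -[leRHS]mul1r ler_pM2r ?invr_gt0//.
by case/andP: (v01 _ Ai).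
Qed.

Section PartitionOfUnity.
Context {R : realType} {X : pseudoMetricType R} {I : choiceType}.
Variable U : I -> set X.
Hypothesis openU : forall i, open (U i).

(* For the well-order [lt], the functions [psi i = max(0, depth (U i) - sup_{j < i} depth (U j))]
   exceed a given [c > 0] at a given point for finitely many [i] only, since
   the corresponding depths are [c]-separated in [0, 1]. Subtracting half of
   the supremum [m] of the [psi i] then gives local finiteness. *)
Lemma locally_finite_bumps : exists h : I -> X -> R,
  [/\ forall i x, 0 <= h i x, forall i, continuous (h i),
      forall i x, 0 < h i x -> U i x,
      forall x, (\bigcup_i U i) x -> exists i, 0 < h i x &
      forall x, (\bigcup_i U i) x -> exists s : seq I,
        uniq s /\ \forall y \near x, forall i, i \notin s -> h i y = 0].
Proof.
have [lt [lt_total lt_min]] := exists_well_founded_total I.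
pose phi i := depth (U i).
pose below i := sup_over phi [set j | lt j i].
pose psi i x := Num.max 0 (phi i x - 1 * below i x).
pose m := sup_over psi setT.
pose h i x := Num.max 0 (psi i x - 2^-1 * m x).
have phi01 i x : 0 <= phi i x <= 1 by exact: depth01.
have phi_lip i : lip 1 (phi i) by exact: depth_lip.
have below_ge0 i x : 0 <= below i x by exact: (sup_over_ge0 phi01).
have below_lip i : lip 1 (below i) by exact: (sup_over_lip phi01).
have psi_lip i : lip 2 (psi i).
  have -> : 2 = 1 + 1 * 1 :> R by rewrite mulr1.
  exact: lip_maxB.
have psi_ge0 i x : 0 <= psi i x by rewrite le_max lexx.
have psi01 i x : 0 <= psi i x <= 1.
  rewrite psi_ge0 ge_max ler01/= mul1r lerBlDr.
  by apply: le_trans (_ : 1 <= _); [case/andP: (phi01 i x)|rewrite lerDl].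
have m_ge0 x : 0 <= m x by exact: (sup_over_ge0 psi01).
have m_lip : lip 2 m by exact: (sup_over_lip psi01).
have psi_phi i x : 0 < psi i x -> below i x + psi i x = phi i x.
  by rewrite /psi; case: (leP 0 (phi i x - 1 * below i x)); rewrite ?ltxx// mul1r; lra.
have m_gt0 x : (\bigcup_i U i) x -> 0 < m x.
  (* At the least index of positive depth, [below] vanishes and so [psi] is positive. *)
  move=> [i0 _ Uix]; have [i /= phi_i lt_i] : exists2 i, 0 < phi i x &
      forall j, lt j i -> ~ 0 < phi j x.
    by apply: (lt_min [set i | 0 < phi i x]); exists i0; exact: depth_gt0.
  apply: (@lt_le_trans _ _ (psi i x)); last first.
    exact: (sup_over_ub psi01 (A := setT) (i := i)).
  have : below i x <= 0.
    by apply: sup_over_le => // j /lt_i/negP; rewrite -leNgt.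
  by rewrite lt_max; lra.
exists h; split.
- by move=> i x; rewrite le_max lexx.
- move=> i; apply: (@lip_continuous _ _ (2 + 2^-1 * 2)).
    by rewrite addr_ge0// mulr_ge0// invr_ge0.
  by apply: lip_maxB; rewrite // invr_ge0.
- move=> i x; rewrite lt_max ltxx/= subr_gt0 => mpsi.
  have : 0 < psi i x by apply: le_lt_trans mpsi; rewrite mulr_ge0// invr_ge0.
  move=> /[dup] psi0 /psi_phi phiE; apply: depth_gt0_mem.
  by rewrite -/(phi i) -phiE ltr_wpDl.
- move=> x /m_gt0 m0; have m2 : 2^-1 * m x < m x by lra.
  have [|i _ mi] := sup_over_gt _ m2; first by rewrite mulr_ge0// invr_ge0.
  by exists i; rewrite lt_max subr_gt0 mi orbT.
- move=> x /m_gt0 m0; pose A := [set i | m x / 4 < psi i x].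
  have m4 : 0 < m x / 4 by rewrite divr_gt0.
  have : finite_set A.
    apply: (@separated_finite R I A (phi^~ x) (m x / 4)) => // i j Ai Aj ij.
    wlog ltij : i j Ai Aj ij / lt i j.
      case: (lt_total _ _ ij) => [ltij|ltji] H; first exact: H.
      by rewrite distrC; apply: H => //; exact: nesym.
    rewrite distrC (lt_le_trans _ (ler_norm _))//.
    have /psi_phi <- : 0 < psi j x by exact: lt_trans Aj.
    apply: (lt_le_trans Aj); rewrite addrAC lerDr subr_ge0.
    exact: (sup_over_ub phi01).
  move=> /finite_seqP[s As]; exists (undup s); split; first exact: undup_uniq.
  (* On this ball the 2-Lipschitz functions [m] and [psi i] change by at most [m x / 8], so
     [psi i y > m y / 2] forces [psi i x > 5 * m x / 16]. *)
  near=> y; have xy : ball x (m x / 16) y.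
    by near: y; apply: nbhsx_ballx; rewrite divr_gt0.
  move=> i; rewrite mem_undup => si; apply/eqP; rewrite eq_le le_max lexx andbT.
  rewrite ge_max lexx/= subr_le0 leNgt; apply/negP => mpsi.
  suff : A i by rewrite As /= => is_; rewrite is_ in si.
  have d0 : 0 < m x / 16 by rewrite divr_gt0.
  have := m_lip _ _ _ d0 xy; have := psi_lip i _ _ _ d0 (ball_sym xy).
  by rewrite /A/=; lra.
Unshelve. all: by end_near. Qed.

(** The bumps divided by their sum. The last clause is local finiteness in the form used later: near
    [x], every weighted sum may be taken over the fixed list [s x], which reduces its continuity to
    that of finitely many weights. *)
Lemma partition_of_unity : exists (w : I -> X -> R) (s : X -> seq I),
  forall x, (\bigcup_i U i) x ->
  [/\ forall i, 0 <= w i x, forall i, 0 < w i x -> U i x,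
      \sum_(i <- s x) w i x = 1,
      forall i, {for x, continuous (w i)} &
      \forall y \near x, forall (V : lmodType R) (f : I -> V),
        \sum_(i <- s y) w i y *: f i = \sum_(i <- s x) w i y *: f i].
Proof.
have [h [h_ge0 h_cont hU h_gt0 h_fin]] := locally_finite_bumps.
have /choice[s sP] x : exists s : seq I, (\bigcup_i U i) x ->
    uniq s /\ \forall y \near x, forall i, i \notin s -> h i y = 0.
  have [/h_fin[s ?]|?] := pselect ((\bigcup_i U i) x); first by exists s.
  by exists [::].
have openO : open (\bigcup_i U i) by exact: bigcup_open.
have sum_near x : (\bigcup_i U i) x -> \forall y \near x,
    forall (V : lmodType R) (f : I -> V),
    \sum_(i <- s y) h i y *: f i = \sum_(i <- s x) h i y *: f i.
  move=> Ox; have [us hs] := sP _ Ox.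
  near=> y => V f.
  have [|us' hs'] := sP y.
    by near: y; exact: (open_nbhs_nbhs (conj openO Ox)).
  move/nbhs_singleton in hs'.
  have hsy i : i \notin s x -> h i y = 0 by move: i; near: y.
  (* Without the terms of zero weight, both lists enumerate the same indices, once each. *)
  have supp t : \sum_(i <- t) h i y *: f i =
      \sum_(i <- [seq i <- t | h i y != 0]) h i y *: f i.
    rewrite big_filter [RHS]big_mkcond; apply: eq_bigr => i _.
    by case: eqP => [->|//]; rewrite scale0r.
  rewrite (supp (s y)) (supp (s x)); apply: perm_big.
  apply: uniq_perm; rewrite ?filter_uniq// => i; rewrite !mem_filter.
  have [//|/= /negbTE hi] := eqVneq (h i y) 0.
  have -> : i \in s x by apply: contraT => /hsy/eqP; rewrite hi.
  by apply: contraT => /hs'/eqP; rewrite hi.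
pose H x := \sum_(i <- s x) h i x.
have HE x : (\bigcup_i U i) x -> \forall y \near x, H y = \sum_(i <- s x) h i y.
  move=> /sum_near; apply: filterS => y /(_ R^o (fun=> 1)).
  by under eq_bigr do rewrite [_ *: _]mulr1;
     under [in RHS]eq_bigr do rewrite [_ *: _]mulr1.
have H_gt0 x : (\bigcup_i U i) x -> 0 < H x.
  move=> Ox; have [us hs] := sP _ Ox; have [i hi] := h_gt0 _ Ox.
  have si : i \in s x.
    apply: contraT => /(nbhs_singleton hs) hi0; by rewrite hi0 ltxx in hi.
  by rewrite /H (bigD1_seq i)//= ltr_pwDl// sumr_ge0.
have H_cont x : (\bigcup_i U i) x -> {for x, continuous H}.
  move=> Ox; apply: (@cvg_trans _ ((fun y => \sum_(i <- s x) h i y) @ x)).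
    by apply: near_eq_cvg; apply: filterS (HE _ Ox) => y ->.
  by apply: cvg_big => [|i _]; [exact: add_continuous|exact: h_cont].
exists (fun i x => h i x / H x), s => x Ox; have H0 := H_gt0 _ Ox; split.
- by move=> i; rewrite divr_ge0// ltW.
- by move=> i; rewrite pmulr_lgt0 ?invr_gt0//; exact: hU.
- by rewrite -mulr_suml divff// gt_eqF.
- move=> i; apply: cvgM; first exact: h_cont.
  by apply: cvgV; [rewrite gt_eqF|exact: H_cont].
- apply: filterS (sum_near _ Ox) => y sumE V f.
  have E t : \sum_(i <- t) (h i y / H y) *: f i =
      (H y)^-1 *: \sum_(i <- t) h i y *: f i.
    by rewrite scaler_sumr; apply: eq_bigr => i _; rewrite scalerA mulrC.
  by rewrite !E sumE.
Unshelve. all: by end_near. Qed.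

End PartitionOfUnity.

(** * Michael's selection theorem for paraconvex values *)

Lemma geometric_cvg (R : realType) (B : completeNormedModType R)
    (u : nat -> B) (a q : R) : 0 <= a -> 0 <= q -> q < 1 ->
  (forall n, `|u n - u n.+1| <= a * q ^+ n) ->
  exists l, forall n, `|u n - l| <= a / (1 - q) * q ^+ n.
Proof.
move=> a0 q0 q1 uS; have q1' : 0 < 1 - q by rewrite subr_gt0.
(* The factor [1 - q ^+ m] comes from the exact geometric partial sum, so that the induction closes
   with an equality. *)
have dist n m : `|u n - u (n + m)%N| <= a / (1 - q) * q ^+ n * (1 - q ^+ m).
  elim: m => [|m IH]; first by rewrite addn0 !subrr normr0 mulr0.
  apply: le_trans (ler_distD (u (n + m)%N) _ _) _; rewrite addnS.
  apply: le_trans (lerD IH (uS _)) _; rewrite exprD exprS le_eqVlt; apply/orP; left.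
  by apply/eqP; field; rewrite gt_eqF.
have : cvgn (series (telescope u)).
  apply: normed_cvg; apply: (@series_le_cvg _ _ (geometric a q)) => [n|n|n|].
  - exact: normr_ge0.
  - exact: geometric_ge0.
  - by rewrite /telescope/= distrC; exact: uS.
  - by apply: is_cvg_geometric_series; rewrite ger0_norm.
move=> /cvg_ex[l' ul']; exists (u 0%N + l') => n; apply/ler_addgt0Pr => e e0.
have : (fun m => u 0%N + series (telescope u) m) @ \oo --> u 0%N + l'.
  by apply: cvgD => //; exact: cvg_cst.
move=> /cvgrPdist_le/(_ _ e0)[N _ uN].
apply: le_trans (ler_distD (u (n + N)%N) _ _) (lerD _ _); last first.
  by have := uN (n + N)%N (leq_addl _ _); rewrite /= -eq_sum_telescope distrC.
apply: le_trans (dist _ _) _; rewrite -[leRHS]mulr1 ler_wpM2l//.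
  by rewrite mulr_ge0// ?exprn_ge0// divr_ge0// ltW.
by rewrite gerBl exprn_ge0.
Qed.

(* Selections take values in functions [T -> B] under uniform closeness. [T := unit]
   gives selections into [B], [T := B] selections into C_b(B, B), with no need for a
   normed space structure on the latter. *)
Section Selection.
Context {R : realType} {X : pseudoMetricType R} {T : Type}.

Section Definitions.
Context {B : normedModType R}.
Implicit Types (g z : T -> B) (A : set (T -> B)) (f : X -> T -> B).

(* dist(g, A) <= s, the infimum not being attained in general. *)
Definition udist_le g A (s : R) :=
  forall e, s < e -> exists2 z, A z & forall t, `|g t - z t| <= e.

Definition ucontinuous_at f (x : X) :=
  forall e : R, 0 < e -> \forall y \near x, forall t, `|f x t - f y t| <= e.

(** Paraconvexity for the sup distance, with closed balls and convex combinations given by weighted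
    lists. Terms of zero weight are unconstrained, as they occur in the lists of a partition of
    unity. *)
Definition uparaconvex (beta : R) A :=
  forall (I : Type) (s : seq I) (w : I -> R) (z : I -> T -> B) c r,
    0 < r -> (forall i, 0 <= w i) -> \sum_(i <- s) w i = 1 ->
    (forall i, 0 < w i -> A (z i) /\ forall t, `|z i t - c t| <= r) ->
    udist_le (fun t => \sum_(i <- s) w i *: z i t) A (beta * r).

End Definitions.

Section Step.
Context {B : normedModType R}.
Variables (O : set X) (F : X -> set (T -> B)) (beta : R).
Hypothesis openO : open O.
Hypothesis F_bounded :
  forall x z, O x -> F x z -> exists M, forall t, `|z t| <= M.
Hypothesis F_lsc : forall x z e, O x -> F x z -> 0 < e ->
  \forall y \near x, exists2 z', F y z' & forall t, `|z t - z' t| <= e.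
Hypothesis F_para : forall x, O x -> uparaconvex beta (F x).

(** Glue almost nearest points [y i] of [F i] by a partition of unity. At [x] each active [y i] is
    within [k * rho x] of some [z i] in [F x] that lies within [(1 + k) * rho x] of [f x];
    paraconvexity bounds the distance from the combination of the [z i] to [F x], and passing to the
    [y i] costs [k * rho x] more. *)
Lemma paraconvex_selection_step (f : X -> T -> B) (rho : X -> R) (k : R) :
  0 < k <= 1 ->
  (forall x, O x -> 0 < rho x) -> (forall x, O x -> {for x, continuous rho}) ->
  (forall x, O x -> ucontinuous_at f x) ->
  (forall x, O x -> udist_le (f x) (F x) (rho x)) ->
  exists g : X -> T -> B, forall x, O x ->
    [/\ ucontinuous_at g x,
        udist_le (g x) (F x) ((beta * (1 + k) + k) * rho x) &
        forall t, `|f x t - g x t| <= (1 + 2 * k) * rho x].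
Proof.
move=> /andP[k0 k1] rho_gt0 rho_cont f_cont f_dist.
have /choice[y yP] x : exists y, O x ->
    F x y /\ forall t, `|f x t - y t| <= (1 + k / 8) * rho x.
  have [Ox|?] := pselect (O x); last by exists (f x).
  have [|y ? ?] := f_dist _ Ox ((1 + k / 8) * rho x); last by exists y.
  by rewrite mulrDl mul1r ltrDl mulr_gt0 ?rho_gt0// divr_gt0.
(* These bounds make the continuity of the glued map uniform in [t]. *)
have /choice[M MP] x : exists M, O x -> forall t, `|y x t| <= M.
  have [Ox|?] := pselect (O x); last by exists 0.
  by have [M ?] := F_bounded Ox (yP _ Ox).1; exists M.
pose V i := [set x | [/\ O i, O x & exists z, [/\ F x z,
  forall t, `|y i t - z t| <= k * rho x &
  forall t, `|f x t - z t| <= (1 + k) * rho x]]].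
pose U i := (V i)°.
have VU i x : U i x -> V i x by exact: interior_subset.
have UO x : O x -> (\bigcup_i U i) x.
  move=> Ox; exists x => //; rewrite /U /interior.
  have r0 := rho_gt0 _ Ox; have d0 : 0 < k / 8 * rho x.
    by rewrite mulr_gt0// divr_gt0.
  have [Fy fy] := yP _ Ox.
  near=> x'.
  have Ox' : O x' by near: x'; exact: open_nbhs_nbhs.
  have ff : forall t, `|f x t - f x' t| <= k / 8 * rho x.
    by near: x'; exact: f_cont.
  have : `|rho x - rho x'| <= k / 8 * rho x.
    by near: x'; move/cvgrPdist_le: (rho_cont _ Ox); exact.
  rewrite ler_norml => /andP[_ rr].
  have [z Fz yz] : exists2 z, F x' z & forall t, `|y x t - z t| <= k / 8 * rho x.
    by near: x'; exact: F_lsc.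
  have rr1 : k / 8 * rho x <= k * rho x' by nra.
  split => //; exists z; split => // t; first exact: le_trans (yz t) rr1.
  have -> : f x' t - z t = (f x' t - f x t) + (f x t - y x t) + (y x t - z t).
    by rewrite subrKA subrKA.
  (* Three errors [k / 8 * rho x] are absorbed: [rho x' >= (1 - k / 8) * rho x], and
     [1 + 3 * k / 8 <= (1 + k) * (1 - k / 8)] for [k <= 1]. *)
  apply: le_trans (ler_normD _ _) _; apply: le_trans (lerD (ler_normD _ _) (yz t)) _.
  rewrite [`|f x' t - _|]distrC; apply: le_trans (lerD (lerD (ff t) (fy t)) (lexx _)) _.
  nra.
have [w [s wP]] := @partition_of_unity R X X U (fun i => @open_interior _ _).
exists (fun x t => \sum_(i <- s x) w i x *: y i t) => x Ox.
have [w_ge0 wU w1 w_cont s_near] := wP _ (UO _ Ox).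
have /choice[z zP] i : exists z, 0 < w i x -> [/\ F x z,
    forall t, `|y i t - z t| <= k * rho x &
    forall t, `|f x t - z t| <= (1 + k) * rho x].
  have [/wU/VU[_ _ [z ?]]|?] := pselect (0 < w i x); first by exists z.
  by exists (y i).
have yz_near t : `|\sum_(i <- s x) w i x *: y i t - \sum_(i <- s x) w i x *: z i t|
    <= k * rho x.
  rewrite -sumrB -[leRHS]mul1r -w1 mulr_suml.
  apply: le_trans (ler_norm_sum _ _ _) _; apply: ler_sum => i _.
  rewrite -scalerBr normrZ ger0_norm//.
  have := w_ge0 i; rewrite le_eqVlt => /predU1P[<-|wi]; first by rewrite !mul0r.
  by rewrite ler_wpM2l//; have [_ + _] := zP _ wi; exact.
have r0 := rho_gt0 _ Ox.
split.
- move=> e e0.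
  have : (fun x' => \sum_(i <- s x) `|w i x - w i x'| * M i) @ x -->
      \sum_(i <- s x) `|w i x - w i x| * M i.
    apply: cvg_big => [|i _]; first exact: add_continuous.
    apply: cvgM; last exact: cvg_cst.
    apply: cvg_norm; apply: cvgB; [exact: cvg_cst|exact: w_cont].
  rewrite big1 => [|i _]; last by rewrite subrr normr0 mul0r.
  move=> /cvgrPdist_le/(_ _ e0) wM.
  near=> x' => t; have -> : \sum_(i <- s x') w i x' *: y i t =
      \sum_(i <- s x) w i x' *: y i t.
    have /(_ B) : forall (V : lmodType R) (g : X -> V),
        \sum_(i <- s x') w i x' *: g i = \sum_(i <- s x) w i x' *: g i.
      by near: x'.
    exact.
  have Ox' : O x' by near: x'; exact: open_nbhs_nbhs.
  have [w_ge0' wU' _ _ _] := wP _ (UO _ Ox').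
  rewrite -sumrB; apply: le_trans (ler_norm_sum _ _ _) _.
  apply: (@le_trans _ _ (\sum_(i <- s x) `|w i x - w i x'| * M i)); last first.
    apply: le_trans (ler_norm _) _; rewrite -normrN -[X in `|X|]add0r.
    by near: x'.
  apply: ler_sum => i _; rewrite -scalerBl normrZ.
  (* [M i] is a bound only for [i] in [O]; the other indices have empty [V i], hence zero weight. *)
  have [Oi|nOi] := pselect (O i); first by rewrite ler_wpM2l// MP.
  have w0 : w i x = 0.
    by have := w_ge0 i; rewrite le_eqVlt => /predU1P[//|/wU/VU[]].
  have w0' : w i x' = 0.
    by have := w_ge0' i; rewrite le_eqVlt => /predU1P[//|/wU'/VU[]].
  by rewrite w0 w0' subrr normr0 !mul0r.
- move=> e er; have para : udist_le (fun t => \sum_(i <- s x) w i x *: z i t)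
      (F x) (beta * ((1 + k) * rho x)).
    apply: (@F_para x Ox _ _ _ _ (f x)) => //.
      by rewrite mulr_gt0// ltr_wpDl// ltW.
    by move=> i /zP[Fz _ fz]; split => // t; rewrite distrC; exact: fz.
  have [|z' Fz' zz'] := para (e - k * rho x); first lra.
  exists z' => // t.
  apply: le_trans (ler_distD (\sum_(i <- s x) w i x *: z i t) _ _) _.
  by have := lerD (yz_near t) (zz' t); lra.
- move=> t; apply: le_trans (ler_distD (\sum_(i <- s x) w i x *: z i t) _ _) _.
  have -> : (1 + 2 * k) * rho x = (1 + k) * rho x + k * rho x by ring.
  apply: lerD; last by rewrite distrC.
  set c := (1 + k) * rho x; rewrite -[f x t]scale1r -w1 scaler_suml -sumrB -[leRHS]mul1r -w1 mulr_suml.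
  apply: le_trans (ler_norm_sum _ _ _) _; apply: ler_sum => i _.
  rewrite -scalerBr normrZ ger0_norm//.
  have := w_ge0 i; rewrite le_eqVlt => /predU1P[<-|wi]; first by rewrite !mul0r.
  by rewrite ler_wpM2l//; have [_ _] := zP _ wi; exact.
Unshelve. all: by end_near. Qed.

End Step.
End Selection.

(** Iterating the step multiplies the distance to [F x] by [q < 1] each time, and the displacements
    add up to at most [(1 + 2 * k) / (1 - q) * rho x], which is below [C * rho x] for small [k]. *)
Theorem paraconvex_selection {R : realType} {X : pseudoMetricType R} {T : Type}
    {B : completeNormedModType R} (O : set X) (F : X -> set (T -> B)) (beta : R)
    (f0 : X -> T -> B) (rho : X -> R) (C : R) :
  open O ->
  (forall x z, O x -> F x z -> exists M, forall t, `|z t| <= M) ->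
  (forall x g, O x -> udist_le g (F x) 0 -> F x g) ->
  (forall x z e, O x -> F x z -> 0 < e ->
    \forall y \near x, exists2 z', F y z' & forall t, `|z t - z' t| <= e) ->
  (forall x, O x -> uparaconvex beta (F x)) ->
  0 <= beta < 1 -> 1 < C * (1 - beta) ->
  (forall x, O x -> 0 < rho x) -> (forall x, O x -> {for x, continuous rho}) ->
  (forall x, O x -> ucontinuous_at f0 x) ->
  (forall x, O x -> udist_le (f0 x) (F x) (rho x)) ->
  exists f : X -> T -> B, forall x, O x ->
    [/\ F x (f x), ucontinuous_at f x &
        forall t, `|f0 x t - f x t| <= C * rho x].
Proof.
move=> openO F_bounded F_closed F_lsc F_para /andP[b0 b1] Cb rho_gt0 rho_cont
  f0_cont f0_dist.
have C0 : 0 < C by nra.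
have D0 : 0 < 2 + C * (1 + beta) by nra.
(* The second argument of the minimum is the [k] that solves [1 + 2 * k = C * (1 - q)] for the [q]
   below. *)
pose k := Num.min 1 ((C * (1 - beta) - 1) / (2 + C * (1 + beta))).
have k0 : 0 < k by rewrite lt_min ltr01 divr_gt0// subr_gt0.
have k1 : k <= 1 by rewrite ge_min lexx.
have kC : k * (2 + C * (1 + beta)) <= C * (1 - beta) - 1.
  by rewrite -ler_pdivlMr// ge_min lexx orbT.
pose q := beta * (1 + k) + k.
have q0 : 0 < q by rewrite /q; nra.
have qC : 1 + 2 * k <= C * (1 - q) by rewrite /q; nra.
have q1 : q < 1 by rewrite /q in qC *; nra.
have q_small (a e : R) : 0 < e -> exists n, a * q ^+ n <= e.
  move=> e0; have : geometric a q @ \oo --> 0.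
    by apply: cvg_geometric; rewrite gtr0_norm.
  move=> /cvgrPdist_le/(_ _ e0)[n _ /(_ n (leqnn n))]; rewrite sub0r normrN => h.
  by exists n; exact: le_trans (ler_norm _) h.
pose inv n (f : X -> T -> B) := forall x, O x ->
  ucontinuous_at f x /\ udist_le (f x) (F x) (q ^+ n * rho x).
(* [next] is a total function, with a guarantee only where the invariant [inv] holds; the stage [n]
   is carried along because [inv] depends on it. *)
have /choice[next nextP] (p : nat * (X -> T -> B)) : exists g, inv p.1 p.2 ->
    inv p.1.+1 g /\ forall x, O x ->
      forall t, `|p.2 x t - g x t| <= (1 + 2 * k) * (q ^+ p.1 * rho x).
  case: p => n f /=; have [fP|?] := pselect (inv n f); last by exists f.
  have qn0 : 0 < q ^+ n by rewrite exprn_gt0.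
  have [||x Ox|x Ox|x Ox|g gP] := paraconvex_selection_step openO F_bounded
    F_lsc F_para (f := f) (rho := fun x => q ^+ n * rho x) (k := k).
  - by rewrite k0.
  - by move=> x Ox; rewrite mulr_gt0// rho_gt0.
  - by apply: cvgM; [exact: cvg_cst|exact: rho_cont].
  - exact: (fP _ Ox).1.
  - exact: (fP _ Ox).2.
  exists g => _; split => x /gP[g1 g2 g3] //; split => //.
  by rewrite exprS -mulrA.
pose fs := fix fs n := if n is m.+1 then next (m, fs m) else f0.
have fs_inv n : inv n (fs n).
  elim: n => [|n IH] /=; last exact: (nextP (n, fs n) IH).1.
  by move=> x Ox; rewrite expr0 mul1r; split; [exact: f0_cont|exact: f0_dist].
have fs_step n x t : O x ->
    `|fs n x t - fs n.+1 x t| <= (1 + 2 * k) * rho x * q ^+ n.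
  move=> Ox; rewrite -mulrA [rho x * _]mulrC.
  by have [_ /(_ _ Ox t)] := nextP (n, fs n) (fs_inv n).
have /choice[f fP] x : exists l : T -> B, O x ->
    forall t n, `|fs n x t - l t| <= C * rho x * q ^+ n.
  have [Ox|?] := pselect (O x); last by exists (f0 x).
  have r0 := rho_gt0 _ Ox.
  suff /choice[l lP] : forall t, exists l,
    forall n, `|fs n x t - l| <= C * rho x * q ^+ n by exists l.
  move=> t; have [||//|n|l lP] := @geometric_cvg _ _ (fs^~ x ^~ t) ((1 + 2 * k) * rho x) q.
  - by rewrite mulr_ge0 ?ltW//; nra.
  - exact: ltW.
  - exact: fs_step.
  exists l => n; apply: le_trans (lP n) _; rewrite ler_pM2r ?exprn_gt0//.
  by rewrite ler_pdivrMr ?subr_gt0// mulrAC ler_pM2r.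
exists f => x Ox; have r0 := rho_gt0 _ Ox; split.
- apply: F_closed => // e e0.
  (* [C] for the distance from the limit to [fs n], and 2 for that from [fs n] to a point of [F x],
     where the infimum may not be attained. *)
  have [n qn] := q_small ((C + 2) * rho x) _ e0.
  have qn0 : 0 < q ^+ n by rewrite exprn_gt0.
  have [|z Fz fz] := (fs_inv n _ Ox).2 (2 * (q ^+ n * rho x)).
    by rewrite ltr_pMl ?mulr_gt0// ltr1n.
  exists z => // t; apply: le_trans (ler_distD (fs n x t) _ _) _.
  by rewrite distrC; have := lerD (fP _ Ox t n) (fz t); lra.
- move=> e e0; have e3 : 0 < e / 3 by rewrite divr_gt0.
  have [n qn] := q_small (C * (2 * rho x)) _ e3.
  near=> y => t.
  have Oy : O y by near: y; exact: open_nbhs_nbhs.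
  have fxy : forall t, `|fs n x t - fs n y t| <= e / 3.
    by near: y; exact: (fs_inv n _ Ox).1.
  (* Then [rho y <= 2 * rho x], so the convergence is uniform near [x]. *)
  have : `|rho x - rho y| <= rho x.
    by near: y; move/cvgrPdist_le: (rho_cont _ Ox); exact.
  rewrite ler_norml => /andP[rxy _].
  have qn0 : 0 < q ^+ n by rewrite exprn_gt0.
  have Cq0 : 0 < C * q ^+ n by rewrite mulr_gt0.
  apply: le_trans (ler_distD (fs n x t) _ _) _.
  apply: le_trans (lerD (lexx _) (ler_distD (fs n y t) _ _)) _.
  have := fP _ Ox t n; have := fP _ Oy t n; have := fxy t.
  rewrite [`|f x t - _|]distrC.
  have : C * q ^+ n * rho y <= C * q ^+ n * (2 * rho x) by rewrite ler_pM2l//; lra.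
  have : C * q ^+ n * rho x <= C * q ^+ n * (2 * rho x) by rewrite ler_pM2l//; lra.
  lra.
- by move=> t; have := fP _ Ox t 0%N; rewrite expr0 mulr1.
Unshelve. all: by end_near. Qed.

(** * Distance to a set, and convex combinations *)

Section SetDist.
Context {R : realType} {B : normedModType R}.
Implicit Types (P : set B) (x y : B).

Lemma near_dist_le x (e : R) : 0 < e -> \forall y \near x, `|x - y| <= e.
Proof. by move=> e0; have /cvgrPdist_le := @cvg_id _ (nbhs x); exact. Qed.

Let set_dist_lbound P x : lbound [set `|x - p| | p in P] 0.
Proof. by move=> ? [p _ <-]. Qed.

Lemma set_dist_le P x p : P p -> set_dist x P <= `|x - p|.
Proof. by move=> Pp; apply: ge_inf; [exists 0; exact: set_dist_lbound|exists p]. Qed.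

Lemma set_dist_ltP P x (e : R) : P !=set0 -> set_dist x P < e ->
  exists2 p, P p & `|x - p| < e.
Proof.
move=> [p Pp] /inf_lt[|_ [q Pq <-] xq]; first by exists `|x - p|, p.
by exists q.
Qed.

Lemma set_dist_ge0 P x : 0 <= set_dist x P.
Proof.
have [[p Pp]|nP] := pselect (P !=set0); last first.
  rewrite /set_dist (_ : [set _ | _ in _] = set0) ?inf0//.
  by rewrite -subset0 => ? [p Pp _]; apply: nP; exists p.
by apply: lb_le_inf (@set_dist_lbound P x); exists `|x - p|, p.
Qed.

Lemma set_dist_triangle P x y : P !=set0 -> set_dist x P <= `|x - y| + set_dist y P.
Proof.
move=> P0; apply/ler_addgt0Pr => e e0.
have [|p Pp yp] := set_dist_ltP (x := y) (e := set_dist y P + e) P0.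
  by rewrite ltrDl.
apply: le_trans (set_dist_le x Pp) _; rewrite -addrA.
by apply: le_trans (ler_distD y _ _) _; rewrite lerD2l ltW.
Qed.

Lemma set_dist_continuous P : P !=set0 -> continuous (set_dist ^~ P).
Proof.
move=> P0 x; apply/cvgrPdist_le => e e0; near=> y.
have xy : `|x - y| <= e by near: y; exact: near_dist_le.
have := set_dist_triangle x y P0; have := set_dist_triangle y x P0.
by rewrite [`|y - x|]distrC ler_norml; lra.
Unshelve. all: by end_near. Qed.

Lemma set_dist_mem P x : P x -> set_dist x P = 0.
Proof.
move=> Px; apply/eqP; rewrite eq_le set_dist_ge0 andbT.
by have := set_dist_le x Px; rewrite subrr normr0.
Qed.

Lemma set_dist_le0 P x : P !=set0 -> closed P -> set_dist x P <= 0 -> P x.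
Proof.
move=> P0 cP xP; apply: cP => A /nbhs_ballP[e /= e0 eA].
have [p Pp xp] := set_dist_ltP P0 (le_lt_trans xP e0).
by exists p; split => //; apply: eA; rewrite -ball_normE.
Qed.

Lemma convex_setP (C : set B) x y (t : R) :
  convex_set C -> C x -> C y -> 0 <= t <= 1 -> C (t *: x + (1 - t) *: y).
Proof.
move=> convC Cx Cy /andP[t0 t1].
by have := convC x y (Itv01 t0 t1) (mem_set Cx) (mem_set Cy); rewrite inE.
Qed.

Lemma convex_set_sum (C : set B) (I : Type) (s : seq I) (w : I -> R) (z : I -> B) :
  convex_set C -> (forall i, 0 <= w i) -> (forall i, 0 < w i -> C (z i)) ->
  \sum_(i <- s) w i = 1 -> C (\sum_(i <- s) w i *: z i).
Proof.
(* Divided by its total weight, the sum makes sense over any list of positive weight, which allows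
   an induction on the list. *)
move=> convC w0 Cz w1; rewrite -[X in C X]scale1r -invr1 -w1.
have : 0 < \sum_(i <- s) w i by rewrite w1.
elim: s {w1} => [|i s IH]; first by rewrite big_nil ltxx.
rewrite !big_cons => wis_gt0.
have := w0 i; rewrite le_eqVlt => /predU1P[wi|wi].
  by move: wis_gt0; rewrite -wi scale0r !add0r.
have : 0 <= \sum_(j <- s) w j by exact: sumr_ge0.
rewrite le_eqVlt => /predU1P[ws|ws].
  have -> : \sum_(j <- s) w j *: z j = 0.
    elim: s ws {IH wis_gt0} => [|j s IH]; first by rewrite !big_nil.
    rewrite !big_cons => /esym/eqP; rewrite paddr_eq0// ?sumr_ge0//.
    by move=> /andP[/eqP -> /eqP ws0]; rewrite IH ?ws0// scale0r add0r.
  by rewrite -ws !addr0 scalerA mulVf ?gt_eqF// scale1r; exact: Cz.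
have := convex_setP (t := w i / (w i + \sum_(j <- s) w j)) convC (Cz _ wi) (IH ws).
set W := \sum_(j <- s) w j in ws wis_gt0 *.
have -> : 1 - w i / (w i + W) = W / (w i + W) by field; rewrite gt_eqF.
rewrite scalerA -mulrA [_^-1 * W^-1]mulrC mulrA divff ?gt_eqF// mul1r.
rewrite [w i / _]mulrC -scalerA -scalerDr; apply.
by rewrite mulrC ler_pdivrMr// mul1r lerDl !(ltW ws, divr_ge0 (ltW wi) (ltW wis_gt0)).
Qed.

(** The closed ball of radius [r] lies in the open balls of radius [r + d]; let [d] tend to 0. *)
Lemma paraconvex_sum (alpha : R) P (I : Type) (s : seq I) (w : I -> R)
    (z : I -> B) (c : B) (r : R) :
  paraconvex alpha P -> 0 <= alpha -> 0 < r ->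
  (forall i, 0 <= w i) -> \sum_(i <- s) w i = 1 ->
  (forall i, 0 < w i -> P (z i) /\ `|z i - c| <= r) ->
  set_dist (\sum_(i <- s) w i *: z i) P <= alpha * r.
Proof.
move=> [_ _ Pa] a0 r0 w0 w1 zP; apply/ler_addgt0Pr => e e0.
pose d := e / (alpha + 1).
have a1 : 0 < alpha + 1 by rewrite ltr_wpDl.
have d0 : 0 < d by rewrite divr_gt0.
have ad : alpha * d <= e.
  by rewrite /d mulrA ler_pdivrMr// mulrC ler_pM2l// lerDl.
apply: (@le_trans _ _ (alpha * (r + d))); last by rewrite mulrDr lerD2l.
apply: (Pa _ c); first exact: addr_gt0.
move=> C [convC PC]; apply: convex_set_sum => // i /zP[Pz zc].
apply: PC; split => //; rewrite -ball_normE /= distrC.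
by apply: le_lt_trans zc _; rewrite ltrDl.
Qed.

End SetDist.

(** * Retractions onto paraconvex sets *)

Lemma paraconvex_retraction (R : realType) (B : completeNormedModType R)
    (alpha C : R) (P : set B) :
  paraconvex alpha P -> 0 <= alpha < 1 -> 1 < C * (1 - alpha) ->
  exists r, continuous_retraction P r /\
    forall x, `|x - r x| <= C * set_dist x P.
Proof.
move=> Pa /andP[a0 a1] Ca; have [P0 cP _] := Pa.
have C0 : 0 < C by nra.
have dist_gt0 x : (~` P) x -> 0 < set_dist x P.
  by move=> nPx; rewrite ltNge; apply/negP => /(set_dist_le0 P0 cP).
have approx x (e : R) : set_dist x P < e ->
    exists2 z : unit -> B, P (z tt) & forall t, `|x - z t| <= e.
  by move=> /(set_dist_ltP P0)[p Pp /ltW xp]; exists (fun=> p).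
have [|x z _ _|x g _ gP|x z e _ Pz e0|x nPx|||x nPx|x nPx|x nPx e e0|x nPx e|f fP] :=
  @paraconvex_selection R B unit B (~` P) (fun=> [set z | P (z tt)]) alpha
    (fun x _ => x) (set_dist ^~ P) C.
- exact: closed_openC.
- by exists `|z tt| => -[].
- apply: set_dist_le0 => //; apply/ler_addgt0Pr => e e0; rewrite add0r.
  have [z Pz gz] := gP e e0; exact: le_trans (set_dist_le _ Pz) (gz tt).
- by apply: nearW => y; exists z => // t; rewrite subrr normr0 ltW.
- move=> I s w z c r r0 w0 w1 zP e re.
  have [|p Pp pe] := @approx (\sum_(i <- s) w i *: z i tt) e.
    apply: le_lt_trans re; apply: (paraconvex_sum (c := c tt)) => // i /zP[? ?].
    by split.
  by exists p => // -[].
- by rewrite a0.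
- by [].
- exact: dist_gt0.
- exact: set_dist_continuous.
- by near=> y => _; near: y; exact: near_dist_le.
- by move=> /approx[z Pz ze]; exists z.
(* The selection off [P] is glued with the identity on [P]. Continuity at [x] in [P] follows from
   [|x - r y| <= |x - y| + C * set_dist y P <= (1 + C) * |x - y|]. *)
pose r x := if `[< P x >] then x else f x tt.
have rP x : P x -> r x = x by rewrite /r; case: asboolP.
have rnP x : ~ P x -> r x = f x tt by rewrite /r; case: asboolP.
have r_dist x : `|x - r x| <= C * set_dist x P.
  have [Px|nPx] := pselect (P x); last by rewrite rnP//; have [_ _] := fP _ nPx; exact.
  by rewrite rP// subrr normr0 mulr_ge0 ?set_dist_ge0// ltW.
exists r; split => //; split => //; last first.
  move=> _ [x _ <-]; have [Px|nPx] := pselect (P x); first by rewrite rP.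
  by rewrite rnP//; have [] := fP _ nPx.
move=> x; have [Px|nPx] := pselect (P x).
  apply/cvgrPdist_le => e e0; rewrite rP//; near=> y.
  have xy : `|x - y| <= e / (1 + C).
    by near: y; apply: near_dist_le; rewrite divr_gt0// addr_gt0.
  rewrite ler_pdivlMr ?addr_gt0// in xy.
  apply: le_trans (ler_distD y _ _) _; apply: le_trans (lerD (lexx _) (r_dist y)) _.
  have := set_dist_le y Px; rewrite [`|y - x|]distrC => yP.
  have : C * set_dist y P <= C * `|x - y| by rewrite ler_pM2l.
  lra.
have openP : open (~` P) by exact: closed_openC.
have [_ fx _] := fP _ nPx.
apply/cvgrPdist_le => e e0; near=> y.
have nPy : (~` P) y by near: y; exact: (open_nbhs_nbhs (conj openP nPx)).
rewrite !rnP//; move: tt; near: y; exact: fx.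
Unshelve. all: by end_near. Qed.

(** * Uniform retractions onto a set *)

Section UniformRetractions.
Context {R : realType} {B : completeNormedModType R}.
Implicit Types (P Q : set B) (r g : B -> B).

(** [URetr] for bare functions, the form taken by the selection theorem; boundedness is recovered at
    the end from that of [P]. *)
Definition uretr P : set (B -> B) :=
  [set r | continuous_retraction P r /\ uniform_wrt P r].

Lemma uretr_closed P g : P !=set0 -> closed P ->
  udist_le g (uretr P) 0 -> uretr P g.
Proof.
move=> P0 cP gP.
have g_near (e : R) : 0 < e -> exists2 z, uretr P z & forall t, `|g t - z t| <= e.
  exact: gP.
split; [split|].
- move=> x; apply/cvgrPdist_le => e e0.
  have e3 : 0 < e / 3 by rewrite divr_gt0.
  have [z [[/(_ x)/cvgrPdist_le/(_ _ e3) zx _ _] _] gz] := g_near _ e3.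
  near=> y; have zxy : `|z x - z y| <= e / 3 by near: y.
  apply: le_trans (ler_distD (z x) _ _) _.
  apply: le_trans (lerD (lexx _) (ler_distD (z y) _ _)) _.
  have := gz x; have := gz y; rewrite [`|z y - _|]distrC; lra.
- move=> _ [x _ <-]; apply: set_dist_le0 => //; apply/ler_addgt0Pr => e e0.
  rewrite add0r; have [z [[_ zP _] _] gz] := g_near _ e0.
  by apply: le_trans (gz x); apply: set_dist_le; apply: zP; exists x.
- move=> a Pa; apply/eqP; rewrite -subr_eq0 -normr_le0; apply/ler_addgt0Pr => e e0.
  rewrite add0r; have [z [[_ _ za] _] gz] := g_near _ e0.
  by rewrite -[X in _ - X](za a Pa).
- move=> e e0; have e2 : 0 < e / 2 by rewrite divr_gt0.
  have [z [_ /(_ _ e2)[d d0 zd]] gz] := g_near _ e2.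
  exists d => // x /zd xz; apply: le_lt_trans (ler_distD (z x) _ _) _.
  by have := gz x; rewrite [`|g x - _|]distrC; lra.
Unshelve. all: by end_near. Qed.

Section WithRetraction.
Variables (P : set B) (rho : B -> B).
Hypothesis P0 : P !=set0.
Hypothesis rhoP : continuous_retraction P rho.
Hypothesis rho_dist : forall x, `|x - rho x| <= 2 * set_dist x P.

(** [rho] moves [g x] by at most twice its distance to [P], itself at most
    [|x - g x| + set_dist x P], so [rho] corrects [g] into [P] without losing uniformity. *)
Lemma uretr_comp (g : B -> B) : continuous g -> (forall a, P a -> g a = a) ->
  uniform_wrt P g -> uretr P (rho \o g).
Proof.
have [rho_cont rho_sub rho_fix] := rhoP.
move=> g_cont g_fix g_unif; split; [split|].
- by move=> x; apply: continuous_comp; [exact: g_cont|exact: rho_cont].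
- by move=> _ [x _ <-]; apply: rho_sub; exists (g x).
- by move=> a Pa /=; rewrite g_fix// rho_fix.
(* The constants come from [3 * (e / 6) + 2 * (e / 4) = e]. *)
- move=> e e0; have e6 : 0 < e / 6 by rewrite divr_gt0.
  have e4 : 0 < e / 4 by rewrite divr_gt0.
  have [d d0 gd] := g_unif _ e6; exists (Num.min d (e / 4)).
    by rewrite lt_min d0.
  move=> x; rewrite lt_min => /andP[/gd xg xe].
  apply: le_lt_trans (ler_distD (g x) _ _) _.
  have := rho_dist (g x); have := set_dist_triangle (g x) x P0.
  by rewrite [`|g x - x|]distrC /=; lra.
Qed.

Lemma uretr_paraconvex (alpha : R) : paraconvex alpha P -> 0 <= alpha ->
  uparaconvex (2 * alpha) (uretr P).
Proof.
move=> Pa a0 I s w z c r r0 w0 w1 zP e re.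
pose q t := \sum_(i <- s) w i *: z i t.
have w_cases i : 0 < w i \/ w i = 0.
  by have := w0 i; rewrite le_eqVlt => /predU1P[<-|]; [right|left].
have qP t : set_dist (q t) P <= alpha * r.
  apply: (paraconvex_sum (c := c t)) => // i /zP[[[_ zP' _] _] zc]; split => //.
  by apply: zP'; exists t.
exists (rho \o q) => [|t]; last first.
  by apply: le_trans (rho_dist (q t)) _; have := qP t; lra.
apply: uretr_comp.
- move=> x; apply: cvg_big => [|i _]; first exact: add_continuous.
  have [/zP[[[zi _ _] _] _]|->] := w_cases i.
    by apply: cvgZr; exact: zi.
  by under eq_fun do rewrite scale0r; rewrite scale0r; exact: cvg_cst.
- move=> a Pa'; rewrite /q -[RHS]scale1r -w1 scaler_suml; apply: eq_bigr => i _.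
  by have [/zP[[[_ _ ->]]]|->] := w_cases i => //; rewrite !scale0r.
(* The finitely many active retractions share a radius, their minimum; an index of zero weight
   provides none and is skipped. *)
have q_unif (u : seq I) (d : R) : 0 < d -> exists2 d', 0 < d' &
    forall x, set_dist x P < d' ->
    \sum_(i <- u) w i * `|x - z i x| <= \sum_(i <- u) w i * d.
  move=> d0; elim: u => [|i u [d1 d10 IH]].
    by exists 1 => // x _; rewrite !big_nil.
  have [/zP[[_ /(_ _ d0)[d2 d20 zd]] _]|wi] := w_cases i; last first.
    by exists d1 => // x /IH; rewrite !big_cons wi !mul0r !add0r.
  exists (Num.min d1 d2); first by rewrite lt_min d10.
  move=> x; rewrite lt_min => /andP[/IH xu /zd xz]; rewrite !big_cons.
  by rewrite lerD// ler_wpM2l// ltW.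
move=> d d0; have d2 : 0 < d / 2 by rewrite divr_gt0.
have [d' d'0 sd] := q_unif s _ d2; exists d' => // x /sd.
rewrite -mulr_suml w1 mul1r => xd; apply: le_lt_trans (_ : d / 2 < d); last lra.
apply: le_trans xd; rewrite /q -[X in X - _]scale1r -w1 scaler_suml -sumrB.
apply: le_trans (ler_norm_sum _ _ _) _; apply: ler_sum => i _.
by rewrite -scalerBr normrZ ger0_norm.
Qed.

(* [rho \o S] maps into [P] but may move the points of [P]; interpolating between
   [S] and the identity near [P] before applying [rho] repairs this. *)
Lemma uretr_perturb Q (S : B -> B) (d d' e : R) : closed P ->
  continuous S -> range S `<=` Q ->
  0 < d <= e -> 2 * d <= d' -> hausdorff_radii Q P d ->
  (forall x, set_dist x Q < d' -> `|x - S x| <= e) ->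
  exists2 S', uretr P S' & forall x, `|S x - S' x| <= 5 * e.
Proof.
move=> cP S_cont SQ /andP[d0 de] dd' [_ QP PQ] S_unif.
(* A cutoff equal to 1 on [P] and to 0 at distance [d] or more; where it is positive, [x] is within
   [2 * d <= d'] of [Q], so [S] moves it by at most [e]. *)
pose lam x := Num.max 0 (1 - set_dist x P / d).
have lam0 x : 0 <= lam x by rewrite le_max lexx.
have dist_d0 x : 0 <= set_dist x P / d by rewrite divr_ge0 ?set_dist_ge0// ltW.
have lam1 x : lam x <= 1 by rewrite ge_max ler01/= gerBl.
have lam_ge x : 1 - lam x <= set_dist x P / d.
  by rewrite lerBlDl -lerBlDr le_max lexx orbT.
pose m x := S x + lam x *: (x - S x).
have near_S x : set_dist x P < d -> `|x - S x| <= e.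
  move=> /(set_dist_ltP P0)[p Pp xp]; apply: S_unif.
  have [y Qy] := PQ _ Pp; rewrite -ball_normE /= => yp.
  apply: le_lt_trans (set_dist_le x Qy) _; apply: le_lt_trans (ler_distD p _ _) _.
  by rewrite [`|p - y|]distrC; lra.
have lam_far x : d <= set_dist x P -> lam x = 0.
  move=> dx; apply/eqP; rewrite eq_le lam0 andbT ge_max lexx/= subr_le0.
  by rewrite ler_pdivlMr// mul1r.
have e0 : 0 <= e by exact: le_trans (ltW d0) de.
have mS x : `|S x - m x| <= e.
  rewrite /m opprD addNKr normrN normrZ ger0_norm//.
  have [/near_S xS|/lam_far ->] := ltP (set_dist x P) d; last by rewrite mul0r.
  by apply: le_trans xS; rewrite ler_piMl.
have dist_S x : set_dist (S x) P <= d.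
  have [p Pp] := QP (S x) (SQ _ (imageT _ _)); rewrite -ball_normE /= => pS.
  by apply: le_trans (set_dist_le _ Pp) _; rewrite distrC ltW.
(* [m x] is within [e] of [S x], hence within [e + d <= 2 * e] of [P], and [rho] moves it by at most
   [4 * e]: in all [5 * e]. *)
exists (rho \o m) => [|x]; last first.
  apply: le_trans (ler_distD (m x) _ _) _.
  have := rho_dist (m x); have := set_dist_triangle (m x) (S x) P0.
  by have := mS x; have := dist_S x; rewrite [`|m x - S x|]distrC /=; lra.
apply: uretr_comp.
- have lam_cont : continuous lam.
    move=> x; apply: (@continuous_comp _ _ _ (fun x => 1 - set_dist x P / d) (Num.max 0)).
      apply: cvgB; first exact: cvg_cst.
      by apply: cvgMl; exact: set_dist_continuous.
    by apply: continuous_max => ?; [exact: cvg_cst|exact: cvg_id].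
  move=> x; apply: cvgD; first exact: S_cont.
  by apply: cvgZ; [exact: lam_cont|apply: cvgB; [exact: cvg_id|exact: S_cont]].
- move=> a Pa; rewrite /m (_ : lam a = 1) ?scale1r ?[RHS]addrC ?subrKC//.
  by rewrite /lam set_dist_mem// mul0r subr0 max_r.
- move=> n n0; have e1 : 0 < e + 1 by rewrite ltr_wpDl.
  exists (Num.min d (n * d / (e + 1))).
    by rewrite lt_min d0 divr_gt0// mulr_gt0.
  move=> x; rewrite lt_min ltr_pdivlMr// => /andP[/near_S xS xn].
  have -> : x - m x = (1 - lam x) *: (x - S x).
    by rewrite /m scalerBl scale1r opprD addrA.
  rewrite normrZ ger0_norm ?subr_ge0//.
  apply: (@le_lt_trans _ _ (set_dist x P / d * e)); first by rewrite ler_pM// subr_ge0.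
  rewrite mulrAC ltr_pdivrMr//; apply: le_lt_trans xn.
  by rewrite ler_wpM2l ?set_dist_ge0// lerDl.
Qed.

End WithRetraction.
End UniformRetractions.

(** * Continuity into C_b(B, B), and the selection itself *)

Lemma ucontinuous_at_cst (R : realType) (X : pseudoMetricType R) (T : Type)
    (B : normedModType R) (g : T -> B) (x : X) : ucontinuous_at (fun=> g) x.
Proof. by move=> e e0; apply: nearW => y t; rewrite subrr normr0 ltW. Qed.

Lemma Cb_valued_continuous (R : realType) (X : pseudoMetricType R)
    (B : normedModType R) (f : X -> Cb B) :
  (forall x, ucontinuous_at f x) -> continuous f.
Proof.
move=> fu x; apply/cvg_ballP => e e0; near=> y; rewrite ballEmdist /=.
apply: (@le_lt_trans _ _ (e / 2)); last by rewrite gtr_pMr// invf_lt1// ltr1n.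
by apply: Cb_dist_le; near: y; apply: fu; rewrite divr_gt0.
Unshelve. all: by end_near. Qed.

Lemma paraconvex_set0 (R : realType) (B : normedModType R) (alpha : R) :
  0 <= alpha -> paraconvex alpha [set (0 : B)].
Proof.
move=> a0; split; first by exists 0.
  by apply: accessible_closed_set1; apply: hausdorff_accessible; exact: norm_hausdorff.
move=> r c q r0 conv_q; rewrite set_dist_mem; first by rewrite mulr_ge0// ltW.
(* The singleton is itself a convex set containing the points whose hull is taken. *)
apply: conv_q; split => [x y l|x []//]; rewrite !inE => -> ->.
by apply: (convmm (s := convex_lmodType B)).
Qed.

Lemma bounded_set0 (R : realType) (B : normedModType R) :
  bounded_set [set (0 : B)].
Proof. by exists 0; split => // M M0 _ -> /=; rewrite normr0 ltW. Qed.

(** A base point: the Hausdorff distance to it controls the norms of the points of a set. *)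
Definition bexp0 (R : realType) (B : normedModType R) (alpha : R)
    (a0 : 0 <= alpha) : bexp B alpha :=
  Bexp (paraconvex_set0 B a0) (@bounded_set0 R B).

Lemma near_bexp (R : realType) (B : normedModType R) (alpha : R)
    (P : bexp B alpha) (e : R) : 0 < e -> \forall Q \near P, bexp_dist P Q < e.
Proof.
by move=> e0; near=> Q; near: Q; exact: nbhsx_ballx.
Unshelve. all: by end_near. Qed.

Theorem proposition2p4 (R : realType) (B : completeNormedModType R) (alpha : R)
    (alpha_ge0 : 0 <= alpha) (alpha_lt : alpha < 2^-1) :
  exists Rr : bexp B alpha -> Cb B,
    continuous Rr /\ forall P : bexp B alpha, URetr P (Rr P).
Proof.
have alpha1 : 0 <= alpha < 1 by rewrite alpha_ge0; lra.
have retr (P : bexp B alpha) := paraconvex_retraction (bexp_paraconvex P) alpha1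
  (_ : 1 < 2 * (1 - alpha)).
have {}retr (P : bexp B alpha) : exists r, continuous_retraction P r /\
    forall x, `|x - r x| <= 2 * set_dist x P by apply: retr; lra.
pose F (P : bexp B alpha) := uretr P.
pose Z := bexp0 B alpha_ge0.
have F_bounded P z : F P z -> exists M, forall t, `|z t| <= M.
  move=> [[_ zP _] _]; have [M _ PM] := pinfty_ex_gt0 (bexp_bounded P).
  by exists M => t; apply: PM; apply: zP; exists t.
have a2 : 0 < 1 - 2 * alpha by lra.
(* The iteration starts from the zero map, whose distance to any retraction onto [P] is at most
   [bexp_dist P Z]; adding 1 makes [rho] positive. The last constant gives
   [C * (1 - 2 * alpha) = 2 > 1]. *)
have [|P z _|P g _|P z e _ Pz e0|P _||||P _|P _|P _ e Pe|f fP] :=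
  @paraconvex_selection R (bexp B alpha) B B setT F (2 * alpha) (fun=> cst 0)
    (fun P => 1 + bexp_dist P Z) (2 / (1 - 2 * alpha)).
- exact: openT.
- exact: F_bounded.
- by have [P0 cP _] := bexp_paraconvex P; exact: uretr_closed.
(* Lower semicontinuity: for [Q] within [d'] of [P], perturbing [z] into a uniform retraction onto
   [Q] costs at most [5 * (e / 6)]. *)
- have [[z_cont zP _] z_unif] := Pz; have e6 : 0 < e / 6 by rewrite divr_gt0.
  have [d d0 zd] := z_unif _ e6.
  pose d' := Num.min (e / 6) (d / 2).
  have d'0 : 0 < d' by rewrite lt_min e6 divr_gt0.
  have d'e : d' <= e / 6 by rewrite ge_min lexx.
  have d'd : 2 * d' <= d by rewrite mulrC -ler_pdivlMr// ge_min lexx orbT.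
  near=> Q; have [r [r_retr r_dist]] := retr Q.
  have PQ : hausdorff_radii P Q d'.
    by apply: bexp_dist_ltP; near: Q; exact: near_bexp.
  have [Q0 cQ _] := bexp_paraconvex Q.
  have d'_e : 0 < d' <= e / 6 by rewrite d'0.
  have [x /zd /ltW//|z' Qz' zz'] := uretr_perturb Q0 r_retr r_dist cQ z_cont zP
    d'_e d'd PQ.
  by exists z' => // t; apply: le_trans (zz' t) _; lra.
- have [r [r_retr r_dist]] := retr P; have Pa := bexp_paraconvex P.
  by have [P0 _ _] := Pa; exact: (uretr_paraconvex P0 r_retr r_dist Pa).
- by rewrite mulr_ge0//=; lra.
- by rewrite divfK ?gt_eqF// ltr1n.
- by move=> P _; rewrite ltr_pwDl// bexp_dist_ge0.
- apply: (@lip_continuous _ _ 1) => // d S Q d0; rewrite ballEmdist => SQ.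
  by have := bexp_dist_triangle Q S Z; move: (ltW SQ : bexp_dist S Q <= d); lra.
- exact: ucontinuous_at_cst.
(* The retraction [r], as [r \o id], is uniform; its values lie in [P], hence within [e] of 0. *)
- have [r [r_retr r_dist]] := retr P; have [P0 _ _] := bexp_paraconvex P.
  exists r => [|t].
    apply: (uretr_comp P0 r_retr r_dist (g := id)) => [x||n n0] //.
    by exists n => // x _; rewrite subrr normr0.
  have [_ rP _] := r_retr; rewrite sub0r normrN.
  have [_ + _] : hausdorff_radii P Z e.
    by apply: bexp_dist_ltP; apply: lt_trans Pe; rewrite ltrDr.
  move=> /(_ (r t)) []; first by apply: rP; exists t.
  by move=> _ ->; rewrite -ball_normE /= sub0r normrN => /ltW.
have f_retr (P : bexp B alpha) : F P (f P) by have [] := fP P Logic.I.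
have f_bounded (P : bexp B alpha) : bounded_fun (f P).
  have [M fM] := F_bounded _ _ (f_retr P).
  by exists M; split => [|N MN x _]; [exact: num_real|exact: le_trans (fM x) (ltW MN)].
have f_cont (P : bexp B alpha) : continuous (f P) by have [[]] := f_retr P.
exists (fun P => MkCb (f_cont P) (f_bounded P)); split; last exact: f_retr.
by apply: Cb_valued_continuous => P; have [] := fP P Logic.I.
Unshelve. all: by end_near. Qed.
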